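(* Let $M_0\in\mathbb{R}^{n\times n}$ be an SDDM matrix with associated weighted graph $\mathcal{G}$, let $b\in\mathbb{R}^n$, let $R$ be a power of $2$, and let $\epsilon\in(0,\frac12]$. For the system $M_0x=b$ with exact solution $x^\star$, there is a distributed algorithm that uses only $R$-hop information and computes an $\epsilon$-close solution $\tilde{x}$, i.e. $\|\tilde{x}-x^\star\|_{M_0}\le\epsilon\|x^\star\|_{M_0}$, in $$T(n,\epsilon)=\mathcal{O}\left(\left(\frac{\beta\,\kappa(M_0)}{R}+\beta\,d_{\max}R\right)\log\frac1\epsilon\right)$$ time steps, where $\kappa(M_0)$ is the condition number of $M_0$, $d_{\max}$ is the maximal degree of $\mathcal{G}$, and $\beta=\min\left\{n,\frac{d_{\max}^{R+1}-1}{d_{\max}-1}\right\}$ is an upper bound on the size of an $R$-hop neighborhood.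
   Context: An SDDM matrix is a symmetric positive definite matrix $M_0$ with non-positive off-diagonal entries and $[M_0]_{ii}\ge-\sum_{j\ne i}[M_0]_{ij}$ for all $i$. Its graph $\mathcal{G}$ has nodes $v_1,\dots,v_n$, with $v_i,v_j$ ($i\neq j$) adjacent iff $[M_0]_{ij}\neq0$. The $R$-hop neighborhood of $v_k$ is $\mathbb{N}_R(v_k)=\{v:\mathrm{dist}(v_k,v)\le R\}$. $\|u\|_{M_0}=\sqrt{u^{\mathsf{T}}M_0u}$, and $\kappa(M_0)=\lambda_{\max}(M_0)/\lambda_{\min}(M_0)$. Distributed model: each node $v_k$ initially knows only the $k$-th row of $M_0$, the entry $[b]_k$, and the parameters (such as $R$, $\epsilon$ and the algorithm's length parameters), and must output $[\tilde x]_k$. Nodes work in parallel; ''using only $R$-hop information'' means each node only uses information from nodes in its $R$-hop neighborhood (at each communication). Time steps count, per node, elementary arithmetic operations and exchanges of single numbers.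
   Formalization: The time bound is read as O(max(1, formula)), since for a diagonal matrix (d_max = 0) the formula tends to 0 as R grows although a step is needed; for d_max = 1 the undefined quotient in β is read as R+1. *)

(* Defs.v *)
(* MathComp world, with MathComp-Analysis for real numbers, sup/inf and ln. *)
From mathcomp Require Import all_boot all_order all_algebra.
From mathcomp Require Import boolp classical_sets reals exp.

Set Implicit Arguments.
Unset Strict Implicit.
Unset Printing Implicit Defensive.

Import Order.TTheory GRing.Theory Num.Theory.
Local Open Scope ring_scope.

Definition quad (K : realType) (n : nat) (M : 'M[K]_n) (u : 'cV[K]_n) : K :=
  (u^T *m M *m u) 0 0.

Definition posdef (K : realType) (n : nat) (M : 'M[K]_n) : Prop :=
  forall u : 'cV[K]_n, u != 0 -> 0 < quad M u.

Definition SDDM (K : realType) (n : nat) (M : 'M[K]_n) : Prop :=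
  [/\ M^T = M,
      posdef M,
      (forall i j : 'I_n, i != j -> M i j <= 0)
    & (forall i : 'I_n, - (\sum_(j < n | j != i) M i j) <= M i i)].

Definition normM (K : realType) (n : nat) (M : 'M[K]_n) (u : 'cV[K]_n) : K :=
  Num.sqrt (quad M u).

(* All eigenvalues of a symmetric real matrix are real, and there are finitely
   many of them, so for n > 0 the sup and inf below are attained. *)
Definition spectrum (K : realType) (n : nat) (M : 'M[K]_n) : set K :=
  [set a | eigenvalue M a]%classic.

Definition lambda_max (K : realType) (n : nat) (M : 'M[K]_n) : K :=
  sup (spectrum M).

Definition lambda_min (K : realType) (n : nat) (M : 'M[K]_n) : K :=
  inf (spectrum M).

Definition cond (K : realType) (n : nat) (M : 'M[K]_n) : K :=
  lambda_max M / lambda_min M.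

Definition adj (K : realType) (n : nat) (M : 'M[K]_n) : rel 'I_n :=
  fun i j => (i != j) && (M i j != 0).

Definition nbrs (K : realType) (n : nat) (M : 'M[K]_n) (k : 'I_n)
  : {set 'I_n} := [set j | adj M k j].

Definition dmax (K : realType) (n : nat) (M : 'M[K]_n) : nat :=
  \max_(k < n) #|nbrs M k|.

(* dist(k, j) <= r: some walk from k with at most r edges ends at j. *)
Definition dist_le (K : realType) (n : nat) (M : 'M[K]_n) (r : nat)
  (k j : 'I_n) : bool :=
  [exists l : 'I_r.+1, [exists p : l.-tuple 'I_n,
     path (adj M) k p && (last k p == j)]].

Definition hop_nbhd (K : realType) (n : nat) (M : 'M[K]_n) (r : nat)
  (k : 'I_n) : {set 'I_n} := [set j | dist_le M r k j].

(* The quotient (d^(r+1) - 1) / (d - 1) stands for 1 + d + ... + d^r, so it is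
   read as r + 1 when d = 1. *)
Definition geom (K : realType) (d r : nat) : K :=
  if d == 1%N then r.+1%:R else (d%:R ^+ r.+1 - 1) / (d%:R - 1).

Definition beta (K : realType) (n : nat) (M : 'M[K]_n) (r : nat) : K :=
  Num.min n%:R (geom K (dmax M) r).

(* Distributed computation.

   Every node is a machine with real registers.  Its program is a finite tree:
   arithmetic on registers, branching on comparisons of registers, and
   synchronous communication rounds.  The tree cannot inspect register contents
   otherwise, so every operation on real numbers is an explicit, charged
   instruction. *)

Inductive reg (n : nat) : Type :=
  | Entry of 'I_n
  | Rhs
  | Prec
  | Work of nat.

Definition reg_eqb (n : nat) (a b : reg n) : bool :=
  match a, b with
  | Entry i, Entry j => i == j
  | Rhs, Rhs => true
  | Prec, Prec => true
  | Work i, Work j => i == j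
  | _, _ => false
  end.

Definition memory (K : realType) (n : nat) : Type := reg n -> K.

Definition upd (K : realType) (n : nat) (m : memory K n) (a : reg n) (v : K)
  : memory K n := fun a' => if reg_eqb a' a then v else m a'.

Inductive arith : Type := Add | Sub | Mul | Div.

Definition arith_eval (K : realType) (o : arith) (x y : K) : K :=
  match o with
  | Add => x + y
  | Sub => x - y
  | Mul => x * y
  | Div => x / y
  end.

(* A fetch (j, src, dst) copies the number in register src of node j into the
   register dst of the fetching node. *)
Definition fetch (n : nat) : Type := ('I_n * reg n * reg n)%type.

Inductive prog (n : nat) : Type :=
  | Halt of reg n
  | Const of reg n & rat & prog n
  | Arith of reg n & arith & reg n & reg n & prog n
  | IfLe of reg n & reg n & prog n & prog n
  | Exchange of seq (fetch n) & prog n.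

(* Runs a node up to its next communication round, or until it halts, and
   counts the instructions executed. *)
Fixpoint local_run (K : realType) (n : nat) (p : prog n) (m : memory K n)
  : prog n * memory K n * nat :=
  match p with
  | Halt _ => (p, m, 0%N)
  | Exchange _ _ => (p, m, 0%N)
  | Const d q p' =>
      let: (p1, m1, t) := local_run p' (upd m d (ratr q)) in (p1, m1, t.+1)
  | Arith d o a b p' =>
      let: (p1, m1, t) := local_run p' (upd m d (arith_eval o (m a) (m b)))
      in (p1, m1, t.+1)
  | IfLe a b p1 p2 =>
      let: (p', m', t) :=
        if m a <= m b then local_run p1 m else local_run p2 m
      in (p', m', t.+1)
  end.

Definition config (K : realType) (n : nat) : Type :=
  'I_n -> prog n * memory K n.

Definition local_phase (K : realType) (n : nat) (c : config K n)
  : config K n := fun k => (local_run (c k).1 (c k).2).1.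

Definition local_time (K : realType) (n : nat) (c : config K n) (k : 'I_n)
  : nat := (local_run (c k).1 (c k).2).2.

Definition fetches (n : nat) (p : prog n) : seq (fetch n) :=
  if p is Exchange fs _ then fs else [::].

(* All fetches of a round read the memories as they were when it began. *)
Definition exchange_phase (K : realType) (n : nat) (c : config K n)
  : config K n := fun k =>
  match (c k).1 with
  | Exchange fs p =>
      (p, foldl (fun m (f : fetch n) => upd m f.2 ((c f.1.1).2 f.1.2))
                (c k).2 fs)
  | _ => c k
  end.

Definition round (K : realType) (n : nat) (c : config K n) : config K n :=
  exchange_phase (local_phase c).

Definition round_fetches (K : realType) (n : nat) (c : config K n) (k : 'I_n)
  : seq (fetch n) := fetches (local_phase c k).1.

Definition hop_local (K : realType) (n : nat) (M : 'M[K]_n) (r : nat)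
  (c : config K n) : bool :=
  [forall k : 'I_n,
     all (fun f : fetch n => f.1.1 \in hop_nbhd M r k) (round_fetches c k)].

(* An exchanged number is charged to both the node that receives it and the
   node that supplies it. *)
Definition node_time (K : realType) (n : nat) (c : config K n) (k : 'I_n)
  : nat :=
  (local_time c k + size (round_fetches c k) +
   \sum_(j < n) count (fun f : fetch n => f.1.1 == k) (round_fetches c j))%N.

(* Nodes work in parallel and the round ends when the slowest one is done; a
   round is never free. *)
Definition round_time (K : realType) (n : nat) (c : config K n) : nat :=
  maxn 1 (\max_(k < n) node_time c k).

(* The program of node k depends on n, on the hop radius, on the length
   parameters, on k, and on the positions of the nonzero off-diagonal entries
   in the k-th row; real data is only available in registers. *)
Definition algorithm : Type :=
  forall n : nat, nat -> seq nat -> 'I_n -> {set 'I_n} -> prog n.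

Definition init_mem (K : realType) (n : nat) (M : 'M[K]_n) (b : 'cV[K]_n)
  (eps : K) (k : 'I_n) : memory K n := fun a =>
  match a with
  | Entry j => M k j
  | Rhs => b k 0
  | Prec => eps
  | Work _ => 0
  end.

Definition init (K : realType) (n : nat) (A : algorithm) (r : nat)
  (ls : seq nat) (M : 'M[K]_n) (b : 'cV[K]_n) (eps : K) : config K n :=
  fun k => (A n r ls k (nbrs M k), init_mem M b eps k).

Definition halted (K : realType) (n : nat) (c : config K n) : bool :=
  [forall k : 'I_n, if (c k).1 is Halt _ then true else false].

Definition output (K : realType) (n : nat) (c : config K n) : 'cV[K]_n :=
  \col_k (if (c k).1 is Halt a then (c k).2 a else 0).

(* From c, all nodes halt with output x after T time steps, and in every
   communication round each node only exchanges numbers with nodes in its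
   r-hop neighborhood. *)
Definition computes (K : realType) (n : nat) (M : 'M[K]_n) (r : nat)
  (c : config K n) (x : 'cV[K]_n) (T : nat) : Prop :=
  exists S : nat,
    [/\ forall s, (s < S)%N -> hop_local M r (iter s (@round K n) c),
        halted (iter S (@round K n) c),
        output (iter S (@round K n) c) = x
      & (\sum_(s < S) round_time (iter s (@round K n) c))%N = T].

(* The Num.max with 1 matters only for graphs without edges, where the formula
   tends to 0 as r grows although at least one division is needed; if
   dmax M >= 1 the formula is at least ln 2. *)
Definition time_bound (K : realType) (n : nat) (M : 'M[K]_n) (r : nat)
  (eps : K) : K :=
  Num.max 1
    ((beta M r * cond M / r%:R + beta M r * (dmax M)%:R * r%:R)
     * ln (eps^-1)).

(* Main.v *)
(* The R-hop radius is not needed: exchanging iterates with direct neighbors is already fast enough.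
   With D the diagonal of M0 and B = D^-1 (D - M0) the Jacobi matrix, the sign of the
   off-diagonal entries and positive definiteness give (1 + 1/k) |B v| <= |v| in the M0-norm for every natural k >= cond M0.  Chebyshev
   acceleration of x := B x + D^-1 b then halves the error in q = O(sqrt k) sweeps, since
   |T_q| <= 1 on [-1, 1] while T_q (1 + 1/k) >= 1 + q^2/k >= 2, and it is restarted
   O(log (1/eps)) times.
   A sweep costs O(dmax), and dmax * sqrt cond <= beta * (cond / R + dmax * R) because
   dmax <= beta and sqrt cond <= cond / R + R.
   Isolated nodes solve their equation by one division and halt. *)
Require Import Defs.
From mathcomp Require Import all_boot all_order all_algebra.
From mathcomp Require Import boolp classical_sets reals exp.
From mathcomp Require Import zify ring lra.

Set Implicit Arguments.
Unset Strict Implicit.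
Unset Printing Implicit Defensive.

Import Order.TTheory GRing.Theory Num.Theory.
Local Open Scope ring_scope.

(** * Bilinear forms given by matrices *)

Definition bil (K : realType) (n : nat) (P : 'M[K]_n) (u v : 'cV[K]_n) : K :=
  (u^T *m P *m v) 0 0.

Lemma bilDl (K : realType) n (P : 'M[K]_n) u v w :
  bil P (u + v) w = bil P u w + bil P v w.
Proof. by rewrite /bil linearD /= !mulmxDl mxE. Qed.

Lemma bilZl (K : realType) n (P : 'M[K]_n) a u w :
  bil P (a *: u) w = a * bil P u w.
Proof. by rewrite /bil linearZ /= -!scalemxAl mxE. Qed.

Lemma bilDr (K : realType) n (P : 'M[K]_n) u v w :
  bil P w (u + v) = bil P w u + bil P w v.
Proof. by rewrite /bil mulmxDr mxE. Qed.

Lemma bilZr (K : realType) n (P : 'M[K]_n) a u w :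
  bil P w (a *: u) = a * bil P w u.
Proof. by rewrite /bil -scalemxAr mxE. Qed.

Lemma bilBl (K : realType) n (P : 'M[K]_n) u v w :
  bil P (u - v) w = bil P u w - bil P v w.
Proof. by rewrite -scaleN1r bilDl bilZl mulN1r. Qed.

Lemma bilBr (K : realType) n (P : 'M[K]_n) u v w :
  bil P w (u - v) = bil P w u - bil P w v.
Proof. by rewrite -scaleN1r bilDr bilZr mulN1r. Qed.

Lemma bilDm (K : realType) n (P Q : 'M[K]_n) u v :
  bil (P + Q) u v = bil P u v + bil Q u v.
Proof. by rewrite /bil mulmxDr mulmxDl mxE. Qed.

Lemma bilZm (K : realType) n (P : 'M[K]_n) a u v :
  bil (a *: P) u v = a * bil P u v.
Proof. by rewrite /bil -scalemxAr -scalemxAl mxE. Qed.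

Lemma bilBm (K : realType) n (P Q : 'M[K]_n) u v :
  bil (P - Q) u v = bil P u v - bil Q u v.
Proof. by rewrite -scaleN1r bilDm bilZm mulN1r. Qed.

Lemma bil_mulr (K : realType) n (P Q : 'M[K]_n) u v :
  bil P u (Q *m v) = bil (P *m Q) u v.
Proof. by rewrite /bil !mulmxA. Qed.

Lemma bil_tr (K : realType) n (P : 'M[K]_n) u v : bil P u v = bil P^T v u.
Proof.
rewrite /bil; have -> (X : 'M[K]_1) : X 0 0 = X^T 0 0 by rewrite mxE.
by rewrite !trmx_mul trmxK mulmxA.
Qed.

Lemma bilC (K : realType) n (P : 'M[K]_n) u v :
  P^T = P -> bil P u v = bil P v u.
Proof. by move=> sP; rewrite bil_tr sP. Qed.

Lemma bilE (K : realType) n (P : 'M[K]_n) u v :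
  bil P u v = \sum_i \sum_j P i j * (u i 0 * v j 0).
Proof.
rewrite /bil mxE exchange_big /=; apply: eq_bigr => j _.
rewrite mxE big_distrl /=; apply: eq_bigr => i _; rewrite mxE; ring.
Qed.

Lemma bil1E (K : realType) n (u : 'cV[K]_n) :
  bil 1%:M u u = \sum_i u i 0 ^+ 2.
Proof.
by rewrite /bil mulmx1 mxE; apply: eq_bigr => i _; rewrite mxE expr2.
Qed.

Lemma bil1_ge0 (K : realType) n (u : 'cV[K]_n) : 0 <= bil 1%:M u u.
Proof. by rewrite bil1E sumr_ge0// => i _; rewrite sqr_ge0. Qed.

Lemma bil1_gt0 (K : realType) n (u : 'cV[K]_n) : u != 0 -> 0 < bil 1%:M u u.
Proof.
move=> u0; rewrite lt_neqAle bil1_ge0 andbT eq_sym.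
apply: contra u0; rewrite bil1E psumr_eq0 => [|i _]; last exact: sqr_ge0.
move=> /allP h; apply/eqP/colP => i; rewrite mxE.
by apply/eqP; rewrite -sqrf_eq0; apply: (implyP (h i _)); rewrite ?mem_index_enum.
Qed.

Lemma sqr_le_bil1 (K : realType) n (u : 'cV[K]_n) i : u i 0 ^+ 2 <= bil 1%:M u u.
Proof.
by rewrite bil1E (bigD1 i)//= lerDl sumr_ge0// => j _; rewrite sqr_ge0.
Qed.

Lemma bil_le_bil1 (K : realType) n (P : 'M[K]_n) u :
  bil P u u <= (\sum_i \sum_j `|P i j|) * bil 1%:M u u.
Proof.
rewrite bilE mulr_suml; apply: ler_sum => i _.
rewrite mulr_suml; apply: ler_sum => j _.
apply: le_trans (ler_norm _) _; rewrite normrM ler_wpM2l ?normr_ge0//.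
have := sqr_le_bil1 u i; have := sqr_le_bil1 u j.
rewrite ler_norml; nra.
Qed.

(** * Extremal eigenvalues of symmetric matrices *)

(** Used in contrapositive form: a semidefinite form without a uniform positive lower bound has a
    singular matrix. *)
Lemma coercive (K : realType) n (P : 'M[K]_n) :
    P^T = P -> P \in unitmx -> (forall u, 0 <= bil P u u) ->
  exists2 c : K, 0 < c & forall u, c * bil 1%:M u u <= bil P u u.
Proof.
move=> sP uP P0; set C := 1 + \sum_i \sum_j `|(invmx P) i j|.
have C0 : 0 < C by rewrite ltr_wpDr// sumr_ge0// => i _; rewrite sumr_ge0.
exists C^-1 => [|u]; first by rewrite invr_gt0.
have h2 : bil (invmx P) u u <= C * bil 1%:M u u.
  by apply: le_trans (bil_le_bil1 _ _) _; rewrite ler_wpM2r ?bil1_ge0// lerDr.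
(* Minimize [s |-> bil P (u - s P^-1 u) (u - s P^-1 u)]. *)
have := P0 (u - C^-1 *: (invmx P *m u)).
have e1 : bil P u (invmx P *m u) = bil 1%:M u u by rewrite bil_mulr mulmxV.
have e2 : bil P (invmx P *m u) (invmx P *m u) = bil (invmx P) u u.
  by rewrite bil_mulr mulmxV// bil_tr trmx1 bil_mulr mul1mx.
rewrite !(bilBl, bilBr, bilZl, bilZr) (bilC (invmx P *m u) u sP) e1 e2 => h.
have C1 : C^-1 * (C^-1 * bil (invmx P) u u) <= C^-1 * bil 1%:M u u.
  by rewrite ler_wpM2l ?invr_ge0 ?(ltW C0)// mulrC ler_pdivrMr// mulrC.
lra.
Qed.

(** The eigenvalue is the largest [t] with [t |u|^2 <= u^T S u] for all [u]. Subtracting it leaves a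
    semidefinite matrix, singular by [coercive], since otherwise [t] could be raised. *)
Lemma min_eigenvalue (K : realType) n (S : 'M[K]_n.+1) : S^T = S ->
  exists2 a, eigenvalue S a & forall u, a * bil 1%:M u u <= bil S u u.
Proof.
move=> sS; set E := [set t : K | forall u, t * bil 1%:M u u <= bil S u u]%classic.
pose e0 : 'cV[K]_n.+1 := delta_mx 0 0.
have e00 : e0 != 0.
  by apply/eqP => /matrixP/(_ 0 0); rewrite !mxE eqxx; apply/eqP; rewrite oner_eq0.
have ubE u : u != 0 -> ubound E (bil S u u / bil 1%:M u u).
  by move=> u0 t /(_ u); rewrite ler_pdivlMr// bil1_gt0.
have supE : has_sup E.
  split; last by exists (bil S e0 e0 / bil 1%:M e0 e0); exact: ubE.
  exists (- \sum_i \sum_j `|(- S) i j|) => u.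
  have := bil_le_bil1 (- S) u.
  have -> : bil (- S) u u = - bil S u u by rewrite -scaleN1r bilZm mulN1r.
  by rewrite mulNr lerNl.
have aE : E (sup E).
  move=> u; have [->|u0] := eqVneq u 0.
    by rewrite -(scale0r 0) !bilZl !mul0r mulr0.
  by rewrite -ler_pdivlMr ?bil1_gt0//; apply: ge_sup supE.1 (ubE _ u0).
exists (sup E); last exact: aE.
set P := S - sup E *: 1%:M.
have sP : P^T = P by rewrite /P linearB/= linearZ/= trmx1 sS.
have PE u : bil P u u = bil S u u - sup E * bil 1%:M u u by rewrite bilBm bilZm.
have nU : P \notin unitmx.
  apply/negP => uP; have [|c c0 hc] := coercive sP uP.
    by move=> u; rewrite PE subr_ge0; exact: aE.
  suff : sup E + c <= sup E by apply/negP; rewrite -ltNge ltrDl.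
  apply: (ub_le_sup supE.2) => u; have := hc u; rewrite PE mulrDl; lra.
have /det0P[v v0 hv] : \det P == 0 by move: nU; rewrite unitmxE unitfE negbK.
apply/eigenvalueP; exists v => //; move: hv; rewrite mulmxBr -scalemxAr mulmx1.
by move/eqP; rewrite subr_eq0 => /eqP.
Qed.

Lemma eigenvalue_bil (K : realType) n (S : 'M[K]_n) a : eigenvalue S a ->
  exists2 u, 0 < bil 1%:M u u & bil S u u = a * bil 1%:M u u.
Proof.
move=> /eigenvalueP[v hv v0]; exists v^T.
  by rewrite bil1_gt0// -trmx0 (inj_eq trmx_inj).
by rewrite /bil trmxK hv mulmx1 -scalemxAl mxE.
Qed.

(** Rayleigh quotients at eigenvectors put every eigenvalue above the one from [min_eigenvalue], so
    the infimum is attained there. *)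
Lemma lambda_minP (K : realType) n (S : 'M[K]_n.+1) : S^T = S ->
  eigenvalue S (lambda_min S) /\
  forall u, lambda_min S * bil 1%:M u u <= bil S u u.
Proof.
move=> sS; have [a ea ha] := min_eigenvalue sS.
suff -> : lambda_min S = a by [].
have lb : lbound (spectrum S) a.
  move=> c /eigenvalue_bil[u u0 hu]; have := ha u.
  by rewrite hu ler_pM2r.
apply/le_anti/andP; split; last by apply: lb_le_inf lb; exists a.
by apply: ge_inf => //; exists a.
Qed.

Lemma lambda_maxP (K : realType) n (S : 'M[K]_n.+1) : S^T = S ->
  forall u, bil S u u <= lambda_max S * bil 1%:M u u.
Proof.
move=> sS; have [|a ea ha] := @min_eigenvalue K n (- S).
  by rewrite linearN /= sS.
have bilN u : bil (- S) u u = - bil S u u by rewrite -scaleN1r bilZm mulN1r.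
suff -> : lambda_max S = - a by move=> u; have := ha u; rewrite bilN; lra.
have ub : ubound (spectrum S) (- a).
  move=> c /eigenvalue_bil[u u0 hu]; have := ha u.
  by rewrite bilN hu lerNr -mulNr ler_pM2r.
have ea' : spectrum S (- a).
  move: ea => /eigenvalueP[v hv v0]; apply/eigenvalueP; exists v => //.
  by rewrite scaleNr -hv mulmxN opprK.
apply/le_anti/andP; split; first by apply: ge_sup ub; exists (- a).
by apply: ub_le_sup => //; exists (- a).
Qed.

(** * The diagonal and Jacobi matrices of an SDDM matrix *)

Definition diag_part (K : realType) n (M : 'M[K]_n) : 'M[K]_n :=
  \matrix_(i, j) (M i i *+ (i == j)).

Lemma bil_delta (K : realType) n (P : 'M[K]_n) i :
  bil P (delta_mx i 0) (delta_mx i 0) = P i i.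
Proof.
rewrite bilE (bigD1 i)//= (bigD1 i)//= !mxE !eqxx !mulr1.
rewrite [X in _ + X + _]big1 => [|j ji].
  by rewrite !big1 ?addr0// => j ji; rewrite big1// => l _; rewrite !mxE (negPf ji)/= mul0r mulr0.
by rewrite !mxE (negPf ji)/= !mulr0.
Qed.

Lemma bil_diag (K : realType) n (M : 'M[K]_n) (u v : 'cV[K]_n) :
  bil (diag_part M) u v = \sum_i M i i * (u i 0 * v i 0).
Proof.
rewrite bilE; apply: eq_bigr => i _; rewrite (bigD1 i)//= mxE eqxx mulr1n.
by rewrite big1 ?addr0// => j ji; rewrite mxE eq_sym (negPf ji) mul0r.
Qed.

Lemma SDDM_diag_gt0 (K : realType) n (M : 'M[K]_n) i : SDDM M -> 0 < M i i.
Proof.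
case=> _ pM _ _; rewrite -bil_delta; apply: pM.
by apply/eqP => /matrixP/(_ i 0)/eqP; rewrite !mxE !eqxx oner_eq0.
Qed.

Lemma SDDM_lambda (K : realType) n (M : 'M[K]_n.+1) : SDDM M ->
  0 < lambda_min M /\ lambda_min M <= lambda_max M.
Proof.
move=> [sM pM _ _]; have [em hm] := lambda_minP sM; split.
  have [u u0 hu] := eigenvalue_bil em.
  have : 0 < quad M u.
    apply: pM; apply: contraTneq u0 => ->.
    by rewrite -(scale0r 0) bilZl mul0r ltxx.
  by rewrite [quad M u]hu pmulr_lgt0.
have [u u0 hu] := eigenvalue_bil em.
by have := lambda_maxP sM u; rewrite hu ler_pM2r.
Qed.

(** Basis vectors bound the diagonal entries by the largest eigenvalue; as forms,
    [D <= lambda_max <= k lambda_min <= k M]. *)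
Lemma quad_ge_diag (K : realType) n (M : 'M[K]_n.+1) (k : nat) u : SDDM M ->
  cond M <= k%:R ->
  bil (diag_part M) u u <= k%:R * bil M u u.
Proof.
move=> hM hk; have [sM _ _ _] := hM; have [l0 lle] := SDDM_lambda hM.
have [_ hm] := lambda_minP sM.
have k0 : 0 <= k%:R :> K by [].
have hl : lambda_max M <= k%:R * lambda_min M by rewrite -ler_pdivrMr.
have h1 : bil (diag_part M) u u <= lambda_max M * bil 1%:M u u.
  rewrite bil_diag bil1E mulr_sumr; apply: ler_sum => i _.
  rewrite -expr2 ler_wpM2r ?sqr_ge0//.
  by have := lambda_maxP sM (delta_mx i 0); rewrite !bil_delta mxE eqxx mulr1.
apply: le_trans h1 _; apply: le_trans (ler_wpM2r (bil1_ge0 u) hl) _.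
by rewrite -mulrA ler_wpM2l.
Qed.

(** The right-hand side is the form of [D + A], where [A = D - M] is entrywise non-negative, so that
    [|u|^T A |u| >= - u^T A u]. *)
Lemma bil_abs (K : realType) n (M : 'M[K]_n) (u : 'cV[K]_n) : SDDM M ->
  bil M (\col_i `|u i 0|) (\col_i `|u i 0|) <=
    2 * bil (diag_part M) u u - bil M u u.
Proof.
move=> [_ _ nM _]; rewrite bil_diag !bilE mulr_sumr -sumrB.
apply: ler_sum => i _; rewrite (bigD1 i)//= [in leRHS](bigD1 i)//= !mxE.
have -> : `|u i 0| * `|u i 0| = u i 0 * u i 0 by rewrite -normrM ger0_norm// -expr2 sqr_ge0.
set a := M i i * _; rewrite opprD addrA.
have -> : 2 * a - a = a by ring.
rewrite lerD2l -sumrN; apply: ler_sum => j ji; rewrite !mxE.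
have := nM i j; rewrite eq_sym ji => /(_ isT) h.
rewrite -subr_ge0; have -> : - (M i j * (u i 0 * u j 0)) - M i j * (`|u i 0| * `|u j 0|) =
  (- M i j) * (u i 0 * u j 0 + `|u i 0 * u j 0|) by rewrite normrM; ring.
by rewrite mulr_ge0 ?oppr_ge0// -lerBlDl sub0r -normrN ler_norm.
Qed.

Lemma bil_diag_abs (K : realType) n (M : 'M[K]_n) (u : 'cV[K]_n) :
  bil (diag_part M) (\col_i `|u i 0|) (\col_i `|u i 0|) = bil (diag_part M) u u.
Proof.
rewrite !bil_diag; apply: eq_bigr => i _.
by rewrite !mxE -normrM ger0_norm// -expr2 sqr_ge0.
Qed.

(** The bound for [M] at the vector of absolute values carries over to [D + A]. It keeps the
    spectrum of the Jacobi matrix away from [-1]. *)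
Lemma quad_ge_diag_signless (K : realType) n (M : 'M[K]_n.+1) (k : nat) u :
  SDDM M -> cond M <= k%:R ->
  bil (diag_part M) u u <= k%:R * (2 * bil (diag_part M) u u - bil M u u).
Proof.
move=> hM hk; rewrite -[in leLHS]bil_diag_abs.
apply: le_trans (quad_ge_diag _ hM hk) _.
by rewrite ler_wpM2l// bil_abs.
Qed.

Definition jacobi (K : realType) n (M : 'M[K]_n) : 'M[K]_n :=
  \matrix_(i, j) (if i == j then 0 else - (M i j / M i i)).

Lemma diag_jacobi (K : realType) n (M : 'M[K]_n) : SDDM M ->
  diag_part M *m jacobi M = diag_part M - M.
Proof.
move=> hM; apply/matrixP => i j; rewrite !mxE (bigD1 i)//= !mxE eqxx big1.
  rewrite addr0 mulr1n; case: eqP => [->|_] /=; first by rewrite mulr1n mulr0 subrr.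
  by rewrite mulr0n add0r mulrN mulrCA divff ?mulr1// gt_eqF// SDDM_diag_gt0.
by move=> l li; rewrite !mxE eq_sym (negPf li) mul0r.
Qed.

Lemma diag_sym (K : realType) n (M : 'M[K]_n) : (diag_part M)^T = diag_part M.
Proof. by apply/matrixP => i j; rewrite !mxE eq_sym; case: eqP => [->|]. Qed.

(** With [A = D - M] and [B] the Jacobi matrix, [M B = A - A D^-1 A] is symmetric. *)
Lemma jacobi_selfadjoint (K : realType) n (M : 'M[K]_n) u v : SDDM M ->
  bil M u (jacobi M *m v) = bil M v (jacobi M *m u).
Proof.
move=> hM; have [sM _ _ _] := hM; have sD := diag_sym M.
have hD w z : bil (diag_part M) w (jacobi M *m z) = bil (diag_part M - M) w z.
  by rewrite bil_mulr diag_jacobi.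
have sDM : (diag_part M - M)^T = diag_part M - M by rewrite linearB /= sD sM.
have hMB w z : bil M w (jacobi M *m z) = bil (diag_part M - M) w z -
    bil (diag_part M) (jacobi M *m z) (jacobi M *m w).
  have e : bil M w (jacobi M *m z) = bil (diag_part M) w (jacobi M *m z)
      - bil (diag_part M - M) w (jacobi M *m z) by rewrite bilBm; ring.
  by rewrite e hD hD (bilC (jacobi M *m z) w sDM).
by rewrite !hMB (bilC u v sDM) (bilC _ (jacobi M *m u) sD).
Qed.

Lemma bil_ge0 (K : realType) n (M : 'M[K]_n) u : posdef M -> 0 <= bil M u u.
Proof.
move=> pM; have [->|/pM/ltW//] := eqVneq u 0.
by rewrite -(scale0r 0) bilZl mul0r.
Qed.

(** [G] and [H] confine the spectrum of the Jacobi matrix [B] to [[-r, r]], [r = k / (k + 1)]. Since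
    [M = D (1 - B)], the claim is non-negativity of [(1 - B) (r^2 - B^2)] for the form of [D]. *)
Lemma jacobi_contracting (K : realType) n (M : 'M[K]_n.+1) (k : nat) v :
    (0 < k)%N -> SDDM M -> cond M <= k%:R ->
  let y := (1 + k%:R^-1) *: (jacobi M *m v) in bil M y y <= bil M v v.
Proof.
move=> k_gt0 hM hk; have [sM pM _ _] := hM; have sD := diag_sym M.
rewrite /= bilZl bilZr; set y := jacobi M *m v.
set D := diag_part M; set A := D - M.
have MDA w z : bil M w z = bil D w z - bil A w z by rewrite /A bilBm; ring.
have sA : A^T = A by rewrite /A linearB /= sD sM.
have DB w z : bil D w (jacobi M *m z) = bil A w z by rewrite bil_mulr diag_jacobi.
(* [D <= k M] gives [k A <= (k - 1) D]; adding [A <= D], the positivity of [M], gives these weights.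
   [H] does the same for [- A]. *)
have G w : (k%:R + 1) * bil A w w <= k%:R * bil D w w.
  have := quad_ge_diag w hM hk; have := bil_ge0 w pM; rewrite -/D MDA; lra.
have H w : - ((k%:R + 1) * bil A w w) <= k%:R * bil D w w.
  have := quad_ge_diag_signless w hM hk; rewrite -/D MDA.
  have := le_trans (bil_ge0 _ pM) (bil_abs w hM); rewrite -/D MDA; lra.
have Dvy : bil D v y = bil A v v by rewrite DB.
have Dyv : bil D y v = bil A v v by rewrite (bilC _ _ sD).
have Ayv : bil A y v = bil D y y by rewrite [RHS]DB.
have Avy : bil A v y = bil D y y by rewrite (bilC _ _ sA).
have k0 : 0 < k%:R :> K by rewrite ltr0n.
(* With [r = k / (k + 1)] and [B] the Jacobi matrix, which is self-adjoint for [D]: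
   [(1 - B) (r^2 - B^2) = (1 - r) (r^2 - B^2) + (r - B) (r + B) (r - B)] and
   [2 r (r^2 - B^2) = (r - B) (r + B) (r - B) + (r + B) (r - B) (r + B)]. *)
have := H (k%:R *: v - (k%:R + 1) *: y).
have := G (k%:R *: v + (k%:R + 1) *: y).
rewrite !(bilBl, bilBr, bilDl, bilDr, bilZl, bilZr) !(Dvy, Dyv, Ayv, Avy) !MDA.
set a0 := bil D v v; set a1 := bil A v v; set a2 := bil D y y; set a3 := bil A y y.
set t := k%:R; set s := t + 1 => h1 h2.
have t0 : 0 < t by [].
have s0 : 0 < s by rewrite addr_gt0.
have h3 : 0 <= t ^+ 2 * a0 - s ^+ 2 * a2.
  rewrite -(pmulr_rge0 _ t0); nra.
have h4 : 0 <= t ^+ 2 * (a0 - a1) - s ^+ 2 * (a2 - a3).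
  rewrite -(pmulr_rge0 _ s0) /s; rewrite /s in h1 h2 h3; nra.
have -> : 1 + t^-1 = s / t by rewrite /s; field; rewrite gt_eqF.
rewrite mulrA -expr2 expr_div_n mulrAC ler_pdivrMr ?exprn_gt0//; lra.
Qed.

(** * Chebyshev polynomials of a matrix and beyond the point 1 *)

(** The pair is [(T_t (Y) e, U_(t-1) (Y) e)], with the Chebyshev polynomials of both kinds. *)
Definition cheb_pair (K : realType) n (Y : 'M[K]_n) (e : 'cV[K]_n) (t : nat)
    : 'cV[K]_n * 'cV[K]_n :=
  iter t (fun p => (Y *m (p.1 + Y *m p.2) - p.2, p.1 + Y *m p.2)) (e, 0).

Lemma cheb_rec (K : realType) n (Y : 'M[K]_n) e t :
  (cheb_pair Y e t.+2).1 =
    2 *: (Y *m (cheb_pair Y e t.+1).1) - (cheb_pair Y e t).1.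
Proof.
rewrite /cheb_pair !iterS; case: (iter t _ _) => f g /=.
rewrite !(mulmxDr, mulmxN) scaler_nat mulr2n.
move: (Y *m (Y *m f)) (Y *m (Y *m (Y *m g))) (Y *m g) => a b c.
by apply/matrixP => i j; rewrite !mxE; ring.
Qed.

(** The Pell identity [T_t^2 + (1 - Y^2) U_(t-1)^2 = 1], read in the form of [M]. It yields
    [|T_t| <= 1] without diagonalizing [Y]. *)
Lemma cheb_bil (K : realType) n (M Y : 'M[K]_n) e t : M^T = M ->
    (forall u v, bil M u (Y *m v) = bil M v (Y *m u)) ->
  let p := cheb_pair Y e t in
  bil M p.1 p.1 + bil M p.2 p.2 - bil M (Y *m p.2) (Y *m p.2) = bil M e e.
Proof.
move=> sM aY; elim: t => [|t]; rewrite /cheb_pair /=; first by rewrite mulmx0 addrK.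
case: (iter t _ _) => f g /= <-.
have e1 : bil M (Y *m (f + Y *m g)) g = bil M (f + Y *m g) (Y *m g).
  by rewrite (bilC _ g sM) aY.
rewrite bilBl !bilBr (bilC g _ sM) e1 !(bilDl, bilDr) (bilC (Y *m g) f sM).
ring.
Qed.

Lemma cheb_le (K : realType) n (M Y : 'M[K]_n) e t : M^T = M ->
    (forall u v, bil M u (Y *m v) = bil M v (Y *m u)) ->
    (forall v, bil M (Y *m v) (Y *m v) <= bil M v v) ->
  bil M (cheb_pair Y e t).1 (cheb_pair Y e t).1 <= bil M e e.
Proof.
move=> sM aY cY; rewrite -(cheb_bil e t sM aY).
by have := cY (cheb_pair Y e t).2; lra.
Qed.

(* The Chebyshev polynomial [T_t] at [1 + h]. *)
Definition cheb (h : rat) (t : nat) : rat :=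
  (iter t (fun p => (p.2, 2 * (1 + h) * p.2 - p.1)) (1, 1 + h)).1.

Lemma chebSS h t : cheb h t.+2 = 2 * (1 + h) * cheb h t.+1 - cheb h t.
Proof. by []. Qed.

Lemma cheb_ge h t : 0 <= h -> 1 + h * t%:R ^+ 2 <= cheb h t.
Proof.
move=> h0; suff [] : 1 + h * t%:R ^+ 2 <= cheb h t /\
    h * (2 * t%:R + 1) <= cheb h t.+1 - cheb h t by [].
elim: t => [|t [IH1 IH2]].
  by split; rewrite /cheb /=; lra.
have t0 : 0 <= t%:R :> rat by [].
have e1 : t.+1%:R = t%:R + 1 :> rat by rewrite -natr1.
have IH1' : 1 + h * t.+1%:R ^+ 2 <= cheb h t.+1 by rewrite e1; nra.
split => //; rewrite chebSS e1.
have : h <= h * cheb h t.+1.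
  rewrite ler_peMr//; apply: le_trans IH1'.
  by rewrite lerDl mulr_ge0// sqr_ge0.
lra.
Qed.

(** * Chebyshev acceleration of the Jacobi iteration *)

(** The weights of Chebyshev semi-iteration, rational so that a program can load them as
    constants. *)
Definition cheb_weight (k t : nat) : rat :=
  if t is t'.+1 then
    2 * (1 + k%:R^-1) * cheb k%:R^-1 t / cheb k%:R^-1 t.+1
  else 1.

Definition sweep (K : realType) n (B : 'M[K]_n) (p : 'cV[K]_n * 'cV[K]_n)
    (w : rat) : 'cV[K]_n * 'cV[K]_n :=
  (ratr w *: (B *m p.1) + (1 - ratr w) *: p.2, p.1).

Lemma cheb_gt0 k t : 0 < cheb k%:R^-1 t.
Proof.
apply: lt_le_trans (cheb_ge t _); last by rewrite invr_ge0.
by rewrite ltr_pwDl// mulr_ge0 ?invr_ge0// sqr_ge0.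
Qed.

(** With [c_t = cheb k%:R^-1 t], a sweep is the three-term recurrence divided by [c_(t+1)], as
    [1 - w = - c_(t-1) / c_(t+1)]. The opening weight [1] erases [p.2], so a cycle can start from
    any pair. *)
Lemma sweep_cheb (K : realType) n (B : 'M[K]_n) (k t : nat) p :
  let Y := (1 + k%:R^-1) *: B in
  let f s := (ratr (cheb k%:R^-1 s))^-1 *: (cheb_pair Y p.1 s).1 in
  foldl (sweep B) p (mkseq (cheb_weight k) t) =
    (f t, if t is t'.+1 then f t' else p.2).
Proof.
move=> Y f; case: t => [|t].
  by rewrite /f /= rmorph1 invr1 scale1r; case: p f.
have hr : ratr (1 + k%:R^-1 : rat) = 1 + k%:R^-1 :> K.
  by rewrite rmorphD rmorph1 fmorphV /= ratr_nat.
have r0 s : ratr (cheb k%:R^-1 s) != 0 :> K.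
  by rewrite fmorph_eq0 gt_eqF// cheb_gt0.
have hk : 1 + k%:R^-1 != 0 :> K by rewrite gt_eqF// ltr_pwDl ?invr_ge0.
elim: t => [|t IH].
  rewrite /sweep /= rmorph1 subrr scale0r addr0 scale1r; congr (_, _); last first.
    by rewrite /f rmorph1 invr1 scale1r.
  by rewrite /f /cheb_pair /= subr0 mulmx0 addr0 /cheb /= hr /Y -scalemxAl scalerA mulVf// scale1r.
rewrite mkseqS -cats1 foldl_cat IH /sweep /=; congr (_, _).
rewrite /f cheb_rec.
set c0 := cheb _ t; set c1 := cheb _ t.+1; set c2 := cheb _ t.+2.
set f0 := (cheb_pair Y p.1 t).1; set f1 := (cheb_pair Y p.1 t.+1).1.
have e2 : ratr c2 = 2 * (1 + k%:R^-1) * ratr c1 - ratr c0 :> K.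
  by rewrite /c2 chebSS rmorphB !rmorphM /= hr ratr_nat.
have r2 : 2 * (1 + k%:R^-1) * ratr c1 - ratr c0 != 0 :> K by rewrite -e2 r0.
have -> : ratr (2 * (1 + k%:R^-1) * c1 / c2) = 2 * (1 + k%:R^-1) * ratr c1 / ratr c2 :> K.
  by rewrite fmorph_div /= !rmorphM /= hr ratr_nat.
rewrite -!scalemxAr /Y -!scalemxAl e2.
rewrite scalerBr !scalerA.
move: (r0 t) (r0 t.+1) r2; rewrite -/c0 -/c1; clearbody f0 f1.
move: (ratr c0 : K) (ratr c1 : K) (1 + k%:R^-1 : K) => x0 x1 h n0 n1 n2.
congr (_ *: _ + _); last rewrite -scaleNr; last congr (_ *: _).
  by field; rewrite ?n0 ?n1 ?n2.
by field; rewrite ?n0 ?n1 ?n2.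
Qed.

Definition cheb_cycle (k q : nat) : seq rat := mkseq (cheb_weight k) q.

(** [T_q (Y)] does not increase the energy, and its divisor is at least [1 + q^2 / k >= 2]. *)
Lemma sweep_cheb_cycle (K : realType) n (M : 'M[K]_n.+1) (k q : nat) p :
    (0 < k)%N -> (k <= q ^ 2)%N -> SDDM M -> cond M <= k%:R ->
  let p' := foldl (sweep (jacobi M)) p (cheb_cycle k q) in
  4 * bil M p'.1 p'.1 <= bil M p.1 p.1.
Proof.
move=> k0 kq hM hk; have [sM pM _ _] := hM.
rewrite /cheb_cycle sweep_cheb /=.
set Y := _ *: jacobi M.
have le := @cheb_le K _ M Y p.1 q sM.
set c := ratr _; set f := (cheb_pair _ _ _).1 in le *.
have {}le : bil M f f <= bil M p.1 p.1.
  apply: le => [u v|v]; rewrite /Y -!scalemxAl.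
    by rewrite !bilZr jacobi_selfadjoint.
  exact: jacobi_contracting.
have c2 : 2 <= c.
  rewrite -(ratr_nat K 2) ler_rat; apply: le_trans (cheb_ge _ _); last by rewrite invr_ge0.
  rewrite (_ : 2 = 1 + 1)// lerD2l ler_pdivlMl ?ltr0n// mulr1 -natrX ler_nat//.
rewrite bilZl bilZr; apply: le_trans le.
have f0 := bil_ge0 f pM.
have c0 : 0 < c by apply: lt_le_trans c2.
have i0 : 0 <= c^-1 by rewrite invr_ge0 ltW.
have i1 : c^-1 <= 2^-1 by rewrite lef_pV2 ?posrE.
have i2 : c^-1 * c^-1 <= 4^-1 by nra.
nra.
Qed.

Lemma sweep_cheb_cycles (K : realType) n (M : 'M[K]_n.+1) (k q m : nat) p :
    (0 < k)%N -> (k <= q ^ 2)%N -> SDDM M -> cond M <= k%:R ->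
  let p' := foldl (sweep (jacobi M)) p (flatten (nseq m (cheb_cycle k q))) in
  4 ^+ m * bil M p'.1 p'.1 <= bil M p.1 p.1.
Proof.
move=> k0 kq hM hk /=; elim: m p => [|m IH] p /=; first by rewrite mul1r.
rewrite foldl_cat exprS -mulrA; apply: le_trans (sweep_cheb_cycle p k0 kq hM hk).
by rewrite ler_pM2l.
Qed.

(* The leading weight [1] is a plain Jacobi step.  Together with the weight [1] that opens the first
   cycle it makes both iterates exact at the isolated nodes. *)
Definition weights (k q m : nat) : seq rat :=
  1 :: flatten (nseq m (cheb_cycle k q)).

Lemma sweep_weights_le (K : realType) n (M : 'M[K]_n.+1) (k q m : nat) e e' :
    (0 < k)%N -> (k <= q ^ 2)%N -> SDDM M -> cond M <= k%:R ->
  let p := foldl (sweep (jacobi M)) (e, e') (weights k q m) in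
  4 ^+ m * bil M p.1 p.1 <= bil M e e.
Proof.
move=> k0 kq hM hk /=; have [_ pM _ _] := hM.
apply: le_trans (sweep_cheb_cycles _ _ k0 kq hM hk) _.
rewrite /sweep /= rmorph1 scale1r subrr scale0r addr0.
have := jacobi_contracting e k0 hM hk; rewrite /= bilZl bilZr.
set h := 1 + _; have h1 : 1 <= h by rewrite lerDl invr_ge0.
apply: le_trans; rewrite mulrA ler_peMl ?mulr_ege1//; exact: bil_ge0.
Qed.

Lemma jacobi_row0 (K : realType) n (M : 'M[K]_n) (i : 'I_n) (v : 'cV[K]_n) :
  nbrs M i = finset.set0 -> (jacobi M *m v) i 0 = 0.
Proof.
move=> /setP hi; rewrite mxE big1// => j _; rewrite mxE; case: eqP => ij; first by rewrite mul0r.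
have := hi j; rewrite finset.in_set0 inE /adj; move/eqP: ij => -> /= /negbFE/eqP ->.
by rewrite mul0r oppr0 mul0r.
Qed.

Lemma sweep_isolated (K : realType) n (M : 'M[K]_n) (i : 'I_n) ws
    (p : 'cV[K]_n * 'cV[K]_n) :
    nbrs M i = finset.set0 -> p.1 i 0 = 0 -> p.2 i 0 = 0 ->
  (foldl (sweep (jacobi M)) p ws).1 i 0 = 0.
Proof.
move=> hi; elim: ws p => [|w ws IH] p //= p1 p2; apply: IH => //=.
by rewrite mxE [X in X + _]mxE [X in _ + X]mxE jacobi_row0// p2 !mulr0 addr0.
Qed.

(** Isolated nodes halt after one division, yet the analysis lets them sweep like the others; both
    give the exact entry. *)
Lemma sweep_weights_isolated (K : realType) n (M : 'M[K]_n) (i : 'I_n) k q m p :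
    (0 < q)%N -> (0 < m)%N -> nbrs M i = finset.set0 ->
  (foldl (sweep (jacobi M)) p (weights k q m)).1 i 0 = 0.
Proof.
case: q m => // q [|m] // _ _ hi; rewrite /weights /=.
by apply: sweep_isolated => //=; rewrite rmorph1 subrr !scale1r !scale0r !addr0 jacobi_row0.
Qed.

(** * The size of hop neighborhoods *)

Lemma dist_leP (K : realType) n (M : 'M[K]_n) r k j :
  reflect (exists p : seq 'I_n, [/\ (size p <= r)%N, path (adj M) k p & last k p = j])
          (dist_le M r k j).
Proof.
apply: (iffP existsP) => [[l /existsP[p /andP[hp /eqP hl]]]|[p [sp hp hl]]].
  by exists p; rewrite size_tuple -ltnS ltn_ord.
have sp' : (size p < r.+1)%N by [].
exists (Ordinal sp'); apply/existsP; exists (in_tuple p).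
by rewrite hp hl eqxx.
Qed.

Lemma hop_nbhdS (K : realType) n (M : 'M[K]_n) r k :
  hop_nbhd M r.+1 k \subset k |: \bigcup_(j in nbrs M k) hop_nbhd M r j.
Proof.
apply/fintype.subsetP => i; rewrite !inE => /dist_leP[[|j p] [sp /= hp hl]].
  by rewrite -hl eqxx.
case/andP: hp => kj hp; apply/orP; right; apply/bigcupP; exists j.
  by rewrite inE.
by rewrite inE; apply/dist_leP; exists p.
Qed.

Lemma geomS (K : realType) d r : geom K d r.+1 = 1 + d%:R * geom K d r.
Proof.
rewrite /geom; case: eqP => [->|/eqP d1]; first by rewrite mul1r addrC natr1.
have d1' : d%:R - 1 != 0 :> K by rewrite subr_eq0 pnatr_eq1.
by rewrite (exprS _ r.+1); field.
Qed.

Lemma geom0 (K : realType) d : geom K d 0 = 1.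
Proof.
rewrite /geom; case: eqP => // /eqP d1.
by rewrite expr1 divff// subr_eq0 pnatr_eq1.
Qed.

Lemma card_nbrs_le (K : realType) n (M : 'M[K]_n) k : (#|nbrs M k| <= dmax M)%N.
Proof. exact: (leq_bigmax k). Qed.

Lemma card_bigcup_le (I T : finType) (A : {set I}) (F : I -> {set T}) :
  (#|\bigcup_(i in A) F i| <= \sum_(i in A) #|F i|)%N.
Proof.
elim/big_rec2: _ => [|i x y _ h]; first by rewrite cards0.
by apply: leq_trans (leq_card_setU _ _).1 _; rewrite leq_add2l.
Qed.

(** A ball of radius [r + 1] is covered by its center and at most [dmax M] balls of radius [r],
    which matches the recursion [geomS]. *)
Lemma card_hop_nbhd_geom (K : realType) n (M : 'M[K]_n) r k :
  #|hop_nbhd M r k|%:R <= geom K (dmax M) r.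
Proof.
elim: r k => [|r IH] k.
  rewrite geom0 -[leRHS]/(1%:R) ler_nat -(cards1 k) subset_leq_card//.
  by apply/fintype.subsetP => i; rewrite !inE => /dist_leP[[|? ?] [// _ _ /= ->]].
rewrite geomS; apply: (@le_trans _ _ (1 + \sum_(j in nbrs M k) #|hop_nbhd M r j|)%N%:R).
  rewrite ler_nat; apply: leq_trans (subset_leq_card (hop_nbhdS _ _ _)) _.
  apply: leq_trans (leq_card_setU _ _).1 _.
  by rewrite cards1 leq_add2l card_bigcup_le.
rewrite natrD lerD2l natr_sum; apply: le_trans (ler_sum _ (fun j _ => IH j)) _.
rewrite sumr_const -[leLHS]mulr_natl ler_wpM2r ?ler_nat ?card_nbrs_le//.
exact: le_trans (IH k).
Qed.

Lemma card_hop_nbhd (K : realType) n (M : 'M[K]_n) r k :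
  #|hop_nbhd M r k|%:R <= beta M r.
Proof.
rewrite /beta le_min card_hop_nbhd_geom andbT ler_nat.
by rewrite -[leqRHS](card_ord n) max_card.
Qed.

Lemma nbrs_hop_nbhd (K : realType) n (M : 'M[K]_n) r k :
  (0 < r)%N -> nbrs M k \subset hop_nbhd M r k.
Proof.
move=> r0; apply/fintype.subsetP => j; rewrite !inE => kj.
by apply/dist_leP; exists [:: j] => /=; rewrite kj.
Qed.

Lemma dmax_le_beta (K : realType) n (M : 'M[K]_n) r :
  (0 < r)%N -> (dmax M)%:R <= beta M r.
Proof.
move=> r0; case: n M => [|n] M.
  have d0 : dmax M = 0%N by rewrite /dmax big_ord0.
  by rewrite /beta d0 le_min lexx /geom mulr0n expr0n sub0r divff ?ler01 ?oppr_eq0 ?oner_eq0.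
rewrite [in leLHS]/dmax; have [|k ->] := @bigop.eq_bigmax _ (fun k => #|nbrs M k|).
  by rewrite card_ord.
by apply: le_trans (card_hop_nbhd M r k); rewrite ler_nat subset_leq_card// nbrs_hop_nbhd.
Qed.

Lemma dmax_eq0 (K : realType) n (M : 'M[K]_n) k : dmax M = 0%N -> nbrs M k = finset.set0.
Proof.
by move=> d0; apply/eqP; rewrite -cards_eq0 -leqn0 -d0 card_nbrs_le.
Qed.

(** * The program of a node and its local execution *)

(* Registers of a node: [Work 0] and [Work 1] hold the current and the previous iterate, [Work 2]
   and [Work 3] are scratch, [Work (4 + j)] receives the iterate of node [j]. *)
Definition recv n (N : seq 'I_n) : seq (fetch n) :=
  [seq (j, Work n 0, Work n (4 + j)) | j : 'I_n <- N].

Definition subtract_row n (N : seq 'I_n) (p : prog n) : prog n :=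
  foldr (fun j p =>
    Arith (Work n 3) Mul (Entry j) (Work n (4 + j))
      (Arith (Work n 2) Defs.Sub (Work n 2) (Work n 3) p)) p N.

(** No instruction moves a register, so copies are made by adding a zero held in [Work 3]. [Work 1]
    is consumed before the current iterate is shifted into it. *)
Definition combine n (k : 'I_n) (w : rat) (p : prog n) : prog n :=
  Arith (Work n 2) Div (Work n 2) (Entry k)
  (Const (Work n 3) w
  (Arith (Work n 2) Mul (Work n 3) (Work n 2)
  (Const (Work n 3) (1 - w)
  (Arith (Work n 1) Mul (Work n 3) (Work n 1)
  (Arith (Work n 2) Add (Work n 2) (Work n 1)
  (Const (Work n 3) 0
  (Arith (Work n 1) Add (Work n 0) (Work n 3)
  (Arith (Work n 0) Add (Work n 2) (Work n 3) p)))))))).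

Definition update_step n (k : 'I_n) (N : seq 'I_n) (w : rat) (p : prog n) : prog n :=
  Const (Work n 3) 0
  (Arith (Work n 2) Add (Rhs n) (Work n 3)
    (subtract_row N (combine k w p))).

Fixpoint sweeps n (k : 'I_n) (N : seq 'I_n) (ws : seq rat) : prog n :=
  if ws is w :: ws' then
    Exchange (recv N) (update_step k N w (sweeps k N ws'))
  else Halt (Work n 0).

(** [ls] lists the [k], [q] and [m] of [weights], so real data never shape the program. *)
Definition solver : algorithm := fun n _ ls k N =>
  if N == finset.set0 then Arith (Work n 0) Div (Rhs n) (Entry k) (Halt (Work n 0))
  else sweeps k (enum N) (weights (nth 0%N ls 0) (nth 0%N ls 1) (nth 0%N ls 2)).

Definition suspended n (p : prog n) : bool :=
  match p with Halt _ | Exchange _ _ => true | _ => false end.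

Lemma local_run_suspended (K : realType) n (p : prog n) (m : memory K n) :
  suspended p -> local_run p m = (p, m, 0%N).
Proof. by case: p. Qed.

Lemma sweeps_suspended n (k : 'I_n) N ws : suspended (sweeps k N ws).
Proof. by case: ws. Qed.

Lemma subtract_row_run (K : realType) n (N : seq 'I_n) p (m : memory K n) :
  exists m' : memory K n,
    [/\ local_run (subtract_row N p) m =
          ((local_run p m').1, (local_run p m').2 + (size N).*2)%N,
        m' (Work n 2) = m (Work n 2) - \sum_(j <- N) m (Entry j) * m (Work n (4 + j))
      & forall a, a <> Work n 2 -> a <> Work n 3 -> m' a = m a].
Proof.
elim: N m => [|j N IH] m.
  exists m; split => //; last by rewrite big_nil subr0.
  by rewrite /= addn0; case: (local_run _ _) => -[].
set m1 := upd m (Work n 3) (m (Entry j) * m (Work n (4 + j))).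
set m2 := upd m1 (Work n 2) (m1 (Work n 2) - m1 (Work n 3)).
have [m' [e1 e2 e3]] := IH m2.
have m2E a : a <> Work n 2 -> a <> Work n 3 -> m2 a = m a.
  by rewrite /m2 /m1 /upd; case: a => //= -[|[|[|[|i]]]].
exists m'; split.
- rewrite /= -/m1 -/m2 e1; case: (local_run p m') => -[? ?] ?.
  by rewrite /= !addnS.
- by rewrite e2 big_cons opprD addrA; congr (_ - _).
- by move=> a h2 h3; rewrite e3 ?m2E.
Qed.

Lemma combine_run (K : realType) n (k : 'I_n) w p (m : memory K n) : suspended p ->
  exists m' : memory K n,
    [/\ local_run (combine k w p) m = (p, m', 9%N),
        m' (Work n 0) = ratr w * (m (Work n 2) / m (Entry k))
          + (1 - ratr w) * m (Work n 1),
        m' (Work n 1) = m (Work n 0),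
        m' (Rhs n) = m (Rhs n)
      & forall j, m' (Entry j) = m (Entry j)].
Proof.
move=> sp; eexists; split; first by rewrite /= local_run_suspended.
- by rewrite /upd /= !rmorph0 addr0 rmorphB rmorph1.
- by rewrite /upd /= rmorph0 addr0.
- by [].
- by [].
Qed.

(** Of the [11] instructions, two load the right-hand side and nine belong to [combine]. *)
Lemma update_step_run (K : realType) n (k : 'I_n) (N : seq 'I_n) w p (m : memory K n) :
  suspended p ->
  exists m' : memory K n,
    [/\ local_run (update_step k N w p) m = (p, m', 11 + (size N).*2)%N,
        m' (Work n 0) = ratr w * ((m (Rhs n) - \sum_(j <- N) m (Entry j) * m (Work n (4 + j)))
           / m (Entry k)) + (1 - ratr w) * m (Work n 1),
        m' (Work n 1) = m (Work n 0),
        m' (Rhs n) = m (Rhs n)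
      & forall j, m' (Entry j) = m (Entry j)].
Proof.
move=> sp; set mA := upd m (Work n 3) (ratr 0).
set mB := upd mA (Work n 2) (mA (Rhs n) + mA (Work n 3)).
have mB2 : mB (Work n 2) = m (Rhs n) by rewrite /mB /mA /upd /= rmorph0 addr0.
have mBE a : a <> Work n 2 -> a <> Work n 3 -> mB a = m a.
  by rewrite /mB /mA /upd; case: a => //= -[|[|[|[|i]]]].
have [m1 [e1 e2 e3]] := subtract_row_run N (combine k w p) mB.
have [m2 [f1 f2 f3 f4 f5]] := combine_run k w m1 sp.
have m1E a : a <> Work n 2 -> a <> Work n 3 -> m1 a = m a.
  by move=> a2 a3; rewrite e3 ?mBE.
exists m2; split.
- by rewrite /= -/mA -/mB e1 f1.
- by rewrite f2 e2 mB2 !m1E//; congr (_ * (_ / _) + _); congr (_ - _).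
- by rewrite f3 m1E.
- by rewrite f4 m1E.
- by move=> j; rewrite f5 m1E.
Qed.

(** [g] gives the memories at the start of the exchange. The targets [Work (4 + j)] differ for
    different [j] and avoid the iterates, so no fetched value is lost. *)
Lemma foldl_recv (K : realType) n (N : seq 'I_n) (g : 'I_n -> memory K n) (m : memory K n) :
  let m' := foldl (fun m (f : fetch n) => upd m f.2 (g f.1.1 f.1.2)) m (recv N) in
  (forall j : 'I_n, m' (Work n (4 + j)) = if j \in N then g j (Work n 0) else m (Work n (4 + j))) /\
  forall a, (forall i : 'I_n, a <> Work n (4 + i)) -> m' a = m a.
Proof.
elim: N m => [|i N IH] m //=.
have [h1 h2] := IH (upd m (Work n (4 + i)) (g i (Work n 0))); split.
  move=> j; rewrite h1 in_cons /upd /= eqn_add2l.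
  have -> : (j == i :> nat) = (j == i) by [].
  by case: eqP => [->|_] //=; case: (_ \in _).
move=> a ha; rewrite h2 // /upd; case: a ha => //= l hl.
by case: eqP => // e; case: (hl i); rewrite e.
Qed.

Lemma nbrs_sym (K : realType) n (M : 'M[K]_n) i j : M^T = M ->
  (i \in nbrs M j) = (j \in nbrs M i).
Proof.
by move=> sM; rewrite !inE /adj eq_sym; have -> : M i j = M j i by rewrite -[in LHS]sM mxE.
Qed.

(** * Correctness and cost of the distributed iteration *)

Definition jacobi_sweep (K : realType) n (M : 'M[K]_n) (b : 'cV[K]_n)
    (p : 'cV[K]_n * 'cV[K]_n) (w : rat) : 'cV[K]_n * 'cV[K]_n :=
  (\col_i (ratr w * ((b i 0 - \sum_(j <- enum (nbrs M i)) M i j * p.1 j 0) / M i i)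
      + (1 - ratr w) * p.2 i 0), p.1).

(** The solution is a fixed point of the Jacobi step and the weights [w] and [1 - w] sum to [1], so
    the errors follow the linear iteration. *)
Lemma jacobi_sweep_error (K : realType) n (M : 'M[K]_n) (b x : 'cV[K]_n) p w :
  (forall i, M i i != 0) -> M *m x = b ->
  let q := jacobi_sweep M b p w in
  (q.1 - x, q.2 - x) = sweep (jacobi M) (p.1 - x, p.2 - x) w.
Proof.
move=> M0 <-; congr (_, _); apply/colP => i; rewrite !mxE /=.
rewrite big_enum /=.
have e (z : 'cV[K]_n) : \sum_(j in nbrs M i) M i j * z j 0 = \sum_j M i j * z j 0 - M i i * z i 0.
  rewrite [X in X - _](bigD1 i)//= addrC addrK [RHS](bigID (mem (nbrs M i)))/=.
  rewrite [X in _ + X]big1 ?addr0; last first.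
    by move=> j; rewrite inE /adj eq_sym => /andP[->/=]; rewrite negbK => /eqP->; rewrite mul0r.
  by apply: eq_bigl => j; rewrite inE /adj eq_sym; case: (_ == i).
have eB (z : 'cV[K]_n) :
    \sum_j jacobi M i j * z j 0 = - (\sum_(j in nbrs M i) M i j * z j 0) / M i i.
  rewrite e (bigD1 i)//= [in RHS](bigD1 i)//= mxE eqxx mul0r add0r [X in X - _]addrC addrK.
  rewrite mulNr mulr_suml -sumrN; apply: eq_bigr => j ji.
  by rewrite mxE eq_sym (negPf ji); ring.
rewrite eB.
have -> : \sum_(j in nbrs M i) M i j * (p.1 - x) j 0 =
    \sum_(j in nbrs M i) M i j * p.1 j 0 - \sum_(j in nbrs M i) M i j * x j 0.
  by rewrite -sumrB; apply: eq_bigr => j _; rewrite !mxE mulrBr.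
rewrite -[\sum_j M i j * x j 0](subrK (M i i * x i 0)) -e.
by field.
Qed.

Lemma computes_round (K : realType) n (M : 'M[K]_n) r (c : config K n) x T :
  hop_local M r c -> computes M r (round c) x T ->
  computes M r c x (round_time c + T).
Proof.
move=> hc [S [h1 h2 h3 h4]]; exists S.+1; split.
- by case=> [//|s] hs; rewrite iterSr; exact: h1.
- by rewrite iterSr.
- by rewrite iterSr.
- rewrite big_ord_recl /= -h4; congr (_ + _)%N.
  by apply: eq_bigr => s _; rewrite -[LHS]/(round_time (iter s.+1 _ c)) iterSr.
Qed.

Lemma computes_halted (K : realType) n (M : 'M[K]_n) r (c : config K n) :
  halted c -> computes M r c (output c) 0.
Proof. by move=> hc; exists 0%N; split => //; rewrite big_ord0. Qed.

(* Where node [k] stands at the end of a local phase, with the weights [ws] still to be processed. *)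
Definition node_at (K : realType) n (M : 'M[K]_n) (b : 'cV[K]_n) (ws : seq rat)
    (p : 'cV[K]_n * 'cV[K]_n) (k : 'I_n) (q : prog n * memory K n) : Prop :=
  if nbrs M k == finset.set0 then q.1 = Halt (Work n 0) /\ q.2 (Work n 0) = b k 0 / M k k
  else
    [/\ q.1 = sweeps k (enum (nbrs M k)) ws,
        q.2 (Work n 0) = p.1 k 0,
        q.2 (Work n 1) = p.2 k 0,
        q.2 (Rhs n) = b k 0
      & forall j, q.2 (Entry j) = M k j].

(** The invariant at the start of a round. Looking past the coming local phase makes it hold
    initially too, when isolated nodes have yet to divide. *)
Definition ready (K : realType) n (M : 'M[K]_n) (b : 'cV[K]_n) (ws : seq rat)
    (p : 'cV[K]_n * 'cV[K]_n) (c : config K n) : Prop :=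
  forall k, node_at M b ws p k (local_phase c k) /\
    (local_time c k <= 11 + (dmax M).*2)%N.

Lemma ready_round (K : realType) n (M : 'M[K]_n) b w ws p (c : config K n) :
  M^T = M -> ready M b (w :: ws) p c ->
  ready M b ws (jacobi_sweep M b p w) (round c).
Proof.
move=> sM hc k; have := (hc k).1; rewrite /node_at.
rewrite [local_phase (round c) k]/local_phase /local_time /round /exchange_phase.
case: (local_phase c k) => q1 q2; have [hk|hk] := boolP (nbrs M k == finset.set0).
  by move=> [/= -> h2].
move=> [/= -> h0 h1 hb hM].
have [F1 F2] := foldl_recv (enum (nbrs M k)) (fun j => (local_phase c j).2) q2.
set m := foldl _ _ _ in F1 F2 *.
have [m' [-> e0 e1 eb eM]] := update_step_run k (enum (nbrs M k)) w m
  (sweeps_suspended k (enum (nbrs M k)) ws).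
split; last by rewrite /= leq_add2l leq_double -cardE card_nbrs_le.
split => //=.
- rewrite e0 mxE !F2// hb hM h1; congr (_ * ((_ - _) / _) + _).
  rewrite [LHS]big_seq [RHS]big_seq; apply: eq_bigr => j hj; rewrite F1 hj F2// hM.
  (* By symmetry [k] is a neighbor of [j], so [j] is not isolated and its [Work 0] holds the
     iterate. *)
  have := (hc j).1; rewrite /node_at; case: ifP => [/eqP/setP/(_ k)|_ [_ -> //]].
  by move: hj; rewrite mem_enum nbrs_sym// => ->; rewrite finset.in_set0.
- by rewrite e1 F2.
- by rewrite eb F2.
- by move=> j; rewrite eM F2.
Qed.

Lemma ready_fetches (K : realType) n (M : 'M[K]_n) b ws p (c : config K n) k :
  ready M b ws p c -> exists s : seq 'I_n,
    [/\ uniq s, {subset s <= nbrs M k} & round_fetches c k = recv s].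
Proof.
move=> /(_ k)[+ _]; rewrite /node_at /round_fetches; case: ifP => _ [-> _].
  by exists [::].
case: ws => [|w ws] /=; first by exists [::].
by move=> *; exists (enum (nbrs M k)); split; rewrite ?enum_uniq// => j; rewrite mem_enum.
Qed.

Lemma ready_hop_local (K : realType) n (M : 'M[K]_n) b r ws p (c : config K n) :
  (0 < r)%N -> ready M b ws p c -> hop_local M r c.
Proof.
move=> r0 hc; apply/forallP => k; have [s [_ hs ->]] := ready_fetches k hc.
rewrite all_map; apply/allP => j /hs hj /=.
exact: (fintype.subsetP (nbrs_hop_nbhd M k r0)).
Qed.

(** Local work takes at most [11 + 2 dmax] and receiving [dmax]. Supplying also takes at most
    [dmax]: by symmetry only neighbors fetch from a node, once each. *)
Lemma ready_round_time (K : realType) n (M : 'M[K]_n) b ws p (c : config K n) :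
  M^T = M -> ready M b ws p c -> (round_time c <= 11 + 4 * dmax M)%N.
Proof.
move=> sM hc; rewrite geq_max; apply/andP; split => //.
apply/bigmax_leqP => k _; rewrite /node_time.
have h1 := (hc k).2.
have h2 : (size (round_fetches c k) <= dmax M)%N.
  have [s [us hs ->]] := ready_fetches k hc.
  rewrite size_map -(card_uniqP us); apply: leq_trans (card_nbrs_le M k).
  by apply/subset_leq_card/fintype.subsetP.
suff : (\sum_(j < n) count (fun f : fetch n => f.1.1 == k) (round_fetches c j) <= dmax M)%N by lia.
apply: leq_trans (card_nbrs_le M k); rewrite -sum1_card [leqRHS]big_mkcond /=.
apply: leq_sum => j _; have [s [us hs ->]] := ready_fetches j hc.
rewrite count_map -[count _ _]/(count_mem k s) count_uniq_mem//.
by case: (boolP (k \in s)) => // /hs; rewrite nbrs_sym// => ->.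
Qed.

Lemma ready_computes (K : realType) n (M : 'M[K]_n) b r ws p (c : config K n) :
    M^T = M -> (0 < r)%N -> ready M b ws p c ->
  exists (x : 'cV[K]_n) (T : nat),
    [/\ computes M r c x T,
        forall k, x k 0 = if nbrs M k == finset.set0 then b k 0 / M k k
          else (foldl (jacobi_sweep M b) p ws).1 k 0
      & (T <= (size ws).+1 * (11 + 4 * dmax M))%N].
Proof.
move=> sM r0; elim: ws p c => [|w ws IH] p c hc.
  (* No exchange is left, so the final round is a mere local phase; it is the extra one in
     [(size ws).+1]. *)
  have e k : round c k = local_phase c k.
    have := (hc k).1; rewrite /node_at /round /exchange_phase.
    by case: ifP => _ [-> _].
  exists (output (round c)), (round_time c + 0)%N; split.
  - apply: computes_round (ready_hop_local r0 hc) (computes_halted _ _ _).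
    apply/forallP => k; rewrite e; have := (hc k).1; rewrite /node_at.
    by case: ifP => _ [-> _].
  - move=> k; rewrite mxE e; have := (hc k).1; rewrite /node_at.
    by case: ifP => _ [-> /= ->].
  - by rewrite addn0 mul1n (ready_round_time sM hc).
have [x [T [h1 h2 h3]]] := IH _ _ (ready_round sM hc).
exists x, (round_time c + T)%N; split => //.
  exact: computes_round (ready_hop_local r0 hc) h1.
by rewrite mulSn leq_add// (ready_round_time sM hc).
Qed.

Lemma init_ready (K : realType) n (M : 'M[K]_n) b R k q m eps :
  ready M b (weights k q m) (0, 0) (init solver R [:: k; q; m] M b eps).
Proof.
move=> i; rewrite /node_at /local_phase /local_time /init /solver /=.
by case: (nbrs M i == _) => //=; split => //; split; rewrite //= mxE.
Qed.

(** Taking the empty list of weights reduces an edgeless run to a single round. *)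
Lemma edgeless_ready (K : realType) n (M : 'M[K]_n) b ws ws' p c :
  dmax M = 0%N -> ready M b ws p c -> ready M b ws' p c.
Proof.
by move=> d0 hc k; have := hc k; rewrite /node_at (dmax_eq0 k d0) eqxx.
Qed.

Lemma foldl_jacobi_sweep_error (K : realType) n (M : 'M[K]_n) (b x : 'cV[K]_n) ws p :
  (forall i, M i i != 0) -> M *m x = b ->
  (foldl (jacobi_sweep M b) p ws).1 - x =
    (foldl (sweep (jacobi M)) (p.1 - x, p.2 - x) ws).1.
Proof.
move=> M0 hx; elim: ws p => [//|w ws IH] p.
by rewrite /= IH -(jacobi_sweep_error p w M0 hx).
Qed.

Lemma isolated_exact (K : realType) n (M : 'M[K]_n) (x : 'cV[K]_n) i :
  M i i != 0 -> nbrs M i = finset.set0 -> (M *m x) i 0 / M i i = x i 0.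
Proof.
move=> M0 /setP hi; rewrite mxE (bigD1 i)//= big1 => [|j ji].
  by rewrite addr0 mulrAC divff// mul1r.
have := hi j; rewrite finset.in_set0 inE /adj eq_sym ji /= => /negbFE/eqP ->.
by rewrite mul0r.
Qed.

(** * Choice of the length parameters and the total time *)

Lemma ln2_gt0 (K : realType) : 0 < ln 2 :> K.
Proof. by rewrite ln_gt0// ltr1n. Qed.

(** For [x] the condition number, these successors are [k] and [q]. As [1 <= sqrt x], the offset [2]
    in [q] is absorbed by the factor [3]. *)
Lemma degree_bounds (K : realType) (x : K) : 1 <= x ->
  ((Num.truncn x).+1 <= (Num.truncn (Num.sqrt x)).+2 ^ 2)%N /\
  ((Num.truncn (Num.sqrt x)).+2%:R <= 3 * Num.sqrt x).
Proof.
move=> x1; have x0 : 0 <= x by apply: le_trans x1.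
have s0 : 0 <= Num.sqrt x by rewrite sqrtr_ge0.
have s1 : 1 <= Num.sqrt x by rewrite -sqrtr1 ler_wsqrtr.
have /andP[h1 h2] := truncn_itv s0; split; last by rewrite -natr1 -natr1; lra.
move: h2; set t := Num.truncn (Num.sqrt x) => h2.
suff : (Num.truncn x < t.+1 ^ 2)%N by lia.
rewrite truncn_lt_nat// -(sqr_sqrtr x0) natrX.
by rewrite ltrXn2r// ?nnegrE.
Qed.

(** [m] is the first integer above [log_2 (1/eps)], a number that is at least [1] because
    [eps <= 1/2]; rounding thus costs at most a factor [2]. *)
Lemma restart_bounds (K : realType) (eps : K) : 0 < eps -> eps <= 2^-1 ->
  let m := (Num.truncn (ln eps^-1 / ln 2)).+1 in
  eps^-1 <= 2 ^+ m /\ m%:R <= 2 / ln 2 * ln eps^-1.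
Proof.
move=> e0 e2 m; have l2 := ln2_gt0 K.
have ie : 2 <= eps^-1 by rewrite -[2]invrK lef_pV2 ?posrE// invr_gt0.
have hl : ln 2 <= ln eps^-1 :> K by rewrite ler_ln ?posrE// invr_gt0.
have h1 : 1 <= ln eps^-1 / ln 2 by rewrite ler_pdivlMr// mul1r.
have /andP[h2 h3] := truncn_itv (le_trans ler01 h1).
split; last by rewrite /m -natr1; lra.
rewrite -ler_ln ?posrE ?invr_gt0 ?exprn_gt0// lnXn//.
rewrite -[ln 2 *+ _]mulr_natl -ler_pdivrMr//; exact: ltW.
Qed.

Lemma chebyshev_solves (K : realType) n (M : 'M[K]_n.+1) (b xstar : 'cV[K]_n.+1) R k q m eps :
    (0 < R)%N -> (0 < k)%N -> (0 < q)%N -> (0 < m)%N -> (k <= q ^ 2)%N ->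
    SDDM M -> cond M <= k%:R -> 0 < eps -> eps^-1 <= 2 ^+ m -> M *m xstar = b ->
  exists (x : 'cV[K]_n.+1) (T : nat),
    [/\ computes M R (init solver R [:: k; q; m] M b eps) x T,
        normM M (x - xstar) <= eps * normM M xstar
      & (T <= (m * q).+2 * (11 + 4 * dmax M))%N].
Proof.
move=> R0 k0 q0 m0 kq hM hk e0 em hx; have [sM pM _ _] := hM.
have [x [T [h1 h2 h3]]] := ready_computes sM R0 (init_ready M b R k q m eps).
have Mi i : M i i != 0 by rewrite gt_eqF// SDDM_diag_gt0.
(* At an isolated node the quotient is the exact entry, and so is the result of the sweeps. *)
have {}h2 : x = (foldl (jacobi_sweep M b) (0, 0) (weights k q m)).1.
  apply/colP => i; rewrite h2; case: ifP => // /eqP hi.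
  rewrite -hx isolated_exact// hx; apply/esym/eqP; rewrite -subr_eq0.
  have := congr1 (fun v : 'cV[K]_n.+1 => v i 0)
    (foldl_jacobi_sweep_error (weights k q m) (0, 0) Mi hx).
  by rewrite !mxE => ->; rewrite sweep_weights_isolated.
have sz : size (weights k q m) = (m * q).+1.
  by rewrite /= size_flatten /shape map_nseq sumn_nseq size_mkseq mulnC.
exists x, T; split => //; last by rewrite -sz.
(* Starting from zero, both initial errors are [- xstar]. Square roots turn the energy factor
   [4 ^+ m] into [2 ^+ m >= 1/eps]. *)
have := sweep_weights_le m (0 - xstar) (0 - xstar) k0 kq hM hk.
have E : x - xstar =
    (foldl (sweep (jacobi M)) (0 - xstar, 0 - xstar) (weights k q m)).1.
  by rewrite h2 (foldl_jacobi_sweep_error _ _ Mi hx).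
lazy zeta; rewrite -E sub0r -scaleN1r bilZl bilZr mulrA mulrN1 opprK mul1r => le.
rewrite /normM; have -> : eps = Num.sqrt (eps ^+ 2) by rewrite sqrtr_sqr ger0_norm// ltW.
rewrite -sqrtrM ?sqr_ge0//; apply: ler_wsqrtr.
rewrite -ler_pdivrMl ?exprn_gt0//; apply: le_trans le.
rewrite ler_wpM2r ?bil_ge0//.
rewrite -exprVn (_ : 4 = 2 ^+ 2); last by rewrite -natrX.
by rewrite -exprM mulnC exprM lerXn2r ?nnegrE ?invr_ge0 ?exprn_ge0 ?(ltW e0).
Qed.

(** Here [45] is [3] times [15], from [m q + 2 <= 3 m q] and [11 + 4 d <= 15 d]. *)
Lemma rounds_cost (m q d : nat) : (0 < m)%N -> (0 < q)%N -> (0 < d)%N ->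
  ((m * q).+2 * (11 + 4 * d) <= 45 * d * (m * q))%N.
Proof.
move=> m0 q0 d0; have mq : (0 < m * q)%N by rewrite muln_gt0 m0.
have -> : (45 * d * (m * q) = 3 * (m * q) * (15 * d))%N by lia.
by apply: leq_mul; lia.
Qed.

(** [270] is [45] times the factors [3] and [2] in the bounds on [q] and [m]. The summand [11] is
    slack here and serves the edgeless case. *)
Lemma time_le (K : realType) n (M : 'M[K]_n.+1) R eps (q m : nat) :
    (0 < R)%N -> (0 < q)%N -> (0 < m)%N -> (0 < dmax M)%N -> 1 <= cond M ->
    0 <= ln eps^-1 -> q%:R <= 3 * Num.sqrt (cond M) ->
    m%:R <= 2 / ln 2 * ln eps^-1 ->
  ((m * q).+2 * (11 + 4 * dmax M))%N%:R <= (270 / ln 2 + 11) * time_bound M R eps.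
Proof.
move=> R0 q0 m0 d0 k1 L0 hq hm.
set d := dmax M in d0 *; set L := ln eps^-1 in L0 hm *; set s := Num.sqrt _ in hq.
have l2 := ln2_gt0 K.
have s0 : 0 <= s by rewrite sqrtr_ge0.
have sE : cond M = s * s by rewrite -expr2 sqr_sqrtr// (le_trans ler01).
have hd : 1 <= d%:R :> K by rewrite ler1n.
have hR : 0 < R%:R :> K by rewrite ltr0n.
have hb : d%:R <= beta M R := dmax_le_beta M R0.
(* If [s <= R], the second term suffices because [1 <= d]; otherwise [s / R > 1] and the first one
   does. *)
have hs : s <= s * s / R%:R + d%:R * R%:R.
  have [sR|Rs] := leP s R%:R.
    apply: (@le_trans _ _ (d%:R * R%:R)); first by rewrite (le_trans sR)// ler_peMl// ltW.
    by rewrite lerDr !mulr_ge0// invr_ge0 ltW.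
  apply: (@le_trans _ _ (s * s / R%:R)); last by rewrite lerDl mulr_ge0// ltW.
  by rewrite ler_pdivlMr// ler_wpM2l// ltW.
have tb : d%:R * s * L <= time_bound M R eps.
  rewrite /time_bound le_max -/L -/d sE; apply/orP; right.
  rewrite ler_wpM2r// -!mulrA -mulrDr !mulrA.
  by rewrite ler_pM.
have tb0 : 0 <= time_bound M R eps by rewrite /time_bound le_max ler01.
have n1 := rounds_cost m0 q0 d0.
apply: (@le_trans _ _ (270 / ln 2 * (d%:R * s * L))).
  apply: (@le_trans _ _ (45 * d%:R * (m%:R * q%:R))).
    by rewrite -!natrM ler_nat.
  have -> : 270 / ln 2 * (d%:R * s * L) = 45 * d%:R * ((2 / ln 2 * L) * (3 * s)).
    by field; rewrite gt_eqF.
  by apply: ler_wpM2l; rewrite ?mulr_ge0// ler_pM.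
rewrite [leRHS]mulrDl -[leLHS]addr0; apply: lerD; last by rewrite mulr_ge0.
by apply: ler_wpM2l => //; rewrite divr_ge0// ltW.
Qed.

Theorem lemma9 (K : realType) :
  exists (A : algorithm) (lengths : nat -> nat -> K -> K -> seq nat) (C : K),
  forall (n : nat) (M0 : 'M[K]_n) (b xstar : 'cV[K]_n) (R : nat) (eps : K),
    SDDM M0 ->
    (exists m : nat, R = (2 ^ m)%N) ->
    0 < eps -> eps <= 2^-1 ->
    M0 *m xstar = b ->
    (forall k : 'I_n, #|hop_nbhd M0 R k|%:R <= beta M0 R) /\
    exists (x : 'cV[K]_n) (T : nat),
      [/\ computes M0 R (init A R (lengths n R eps (cond M0)) M0 b eps) x T,
          normM M0 (x - xstar) <= eps * normM M0 xstar
        & T%:R <= C * time_bound M0 R eps].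
Proof.
exists solver.
(* In order: [k], just above the condition number; [q], the sweeps per cycle; [m], the number of
   cycles. *)
exists (fun _ _ eps kappa => [:: (Num.truncn kappa).+1;
  (Num.truncn (Num.sqrt kappa)).+2; (Num.truncn (ln eps^-1 / ln 2)).+1]).
exists (270 / ln 2 + 11) => n M b xstar R eps hM [l Rl] e0 e2 hx.
split=> [k|]; first exact: card_hop_nbhd.
have R0 : (0 < R)%N by rewrite Rl expn_gt0.
have [sM _ _ _] := hM.
set k := (Num.truncn _).+1; set q := (Num.truncn _).+2; set m := (Num.truncn _).+1.
(* Without edges one round of cost at most [11] is charged to the [1] inside [time_bound]. *)
have [d0|d0] := posnP (dmax M).
  have := edgeless_ready [::] d0 (init_ready M b R k q m eps).
  move=> /(ready_computes sM R0)[x [T [h1 h2 h3]]]; exists x, T.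
  have hxs : x = xstar.
    apply/colP => i; rewrite h2 (dmax_eq0 i d0) eqxx -hx isolated_exact ?(dmax_eq0 i d0)//.
    by rewrite gt_eqF// SDDM_diag_gt0.
  have l2 := ln2_gt0 K; split => //.
    rewrite hxs subrr /normM -(scale0r 0) [quad _ _]bilZl mul0r sqrtr0.
    by rewrite mulr_ge0 ?sqrtr_ge0// ltW.
  have h11 : 11 <= 270 / ln 2 + 11 :> K by rewrite lerDr divr_ge0// ltW.
  apply: (@le_trans _ _ (11 * 1)).
    by rewrite mulr1 ler_nat; apply: leq_trans h3 _; rewrite d0.
  by rewrite ler_pM// /time_bound le_max lexx.
(* The eigenvalue bounds need positive dimension; in dimension [0] there are no edges. *)
case: n => [|n] in M b xstar hM hx sM k q d0 *.
  by move: d0; rewrite /dmax big_ord0.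
have [l0 l1] := SDDM_lambda hM.
have k1 : 1 <= cond M by rewrite /cond ler_pdivlMr// mul1r.
have [kq hq] := degree_bounds k1; have [em hm] := restart_bounds e0 e2.
have hk : cond M <= k%:R by rewrite ltW// truncnS_gt.
have [x [T [h1 h2 h3]]] := @chebyshev_solves K n M b xstar R k q m eps
  R0 isT isT isT kq hM hk e0 em hx.
exists x, T; split => //.
apply: le_trans (_ : _ <= ((m * q).+2 * (11 + 4 * dmax M))%N%:R) _; first by rewrite ler_nat.
apply: time_le => //.
by rewrite ln_ge0// invf_ge1// (le_trans e2)// invf_le1// ler1n.
Qed.
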